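(* For the class of digraphs with $n$ nodes and independence number at most $\alpha$, any $p$-pass streaming algorithm for determining $n$-pair reachability, or for detecting a directed triangle, requires $\Omega(\alpha n/p)$ space.
   Context: All digraphs are simple; the independence number of a digraph is that of its underlying undirected graph. The $n$-pair reachability problem: given a digraph $G$ on $n$ nodes and $n$ pairs of nodes $(u_1,v_1),\dots,(u_n,v_n)$, output $w\in\{0,1\}^n$ with $w_i=1$ iff $G$ contains a directed path from $u_i$ to $v_i$. Directed triangle detection: decide whether $G$ contains a directed cycle of length $3$. Graph streaming model: arcs arrive in adversarial order and the algorithm makes $p$ forward passes over the stream. Space lower bounds are measured in bits. *)

(* Defs.v *)
From HB Require Import structures.
From mathcomp Require Import all_boot all_order all_algebra.

Set Implicit Arguments.
Unset Strict Implicit.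
Unset Printing Implicit Defensive.

(* Simple digraphs on a finite node type V are relations [G : rel V] with
   [irreflexive G]: no loops, no parallel arcs, 2-cycles allowed. *)

Section Digraph.
Variable V : finType.
Implicit Types (G : rel V) (S : {set V}).

Definition underlying G : rel V := [rel x y | G x y || G y x].

Definition independent (E : rel V) S : bool :=
  [forall x in S, forall y in S, ~~ E x y].

Definition independence_number G : nat :=
  \max_(S : {set V} | independent (underlying G) S) #|S|.

(* In a loopless digraph the three nodes are necessarily distinct. *)
Definition has_directed_triangle G : bool :=
  [exists x, exists y, exists z, [&& G x y, G y z & G z x]].

(* [sigma] lists every arc of [G] exactly once, in some order. *)
Definition is_stream G (sigma : seq (V * V)) : Prop :=
  uniq sigma /\ forall x y, ((x, y) \in sigma) = G x y.

End Digraph.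

(* A deterministic streaming algorithm with [s] bits of memory. Output bits are
   appended to a write-only tape that is not charged as space; both transition
   functions know the index of the current pass for free, and [alg_end_pass] is
   applied when the end of the stream is reached in each pass. *)
Record stream_alg (T : Type) (s : nat) := StreamAlg {
  alg_init : s.-tuple bool;
  alg_step : nat -> s.-tuple bool -> T -> s.-tuple bool * seq bool;
  alg_end_pass : nat -> s.-tuple bool -> s.-tuple bool * seq bool
}.

Section Run.
Variables (T : Type) (s : nat) (A : stream_alg T s).

(* A configuration is the memory content and the tape written so far. *)
Definition config : Type := (s.-tuple bool * seq bool)%type.

Definition emit (out : seq bool) (c : config) : config := (c.1, out ++ c.2).

Definition run_step (k : nat) (c : config) (a : T) : config :=
  emit c.2 (alg_step A k c.1 a).

Definition run_pass (sigma : seq T) (c : config) (k : nat) : config :=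
  let c' := foldl (run_step k) c sigma in emit c'.2 (alg_end_pass A k c'.1).

Definition run (p : nat) (sigma : seq T) : config :=
  foldl (run_pass sigma) (alg_init A, [::]) (iota 0 p).

Definition output (p : nat) (sigma : seq T) : seq bool := (run p sigma).2.

End Run.

(* A randomized algorithm is a family of deterministic ones indexed by the
   outcome of [r] fair coin tosses; the coins are not charged as space. *)
Definition rand_stream_alg (r : nat) (T : Type) (s : nat) : Type :=
  r.-tuple bool -> stream_alg T s.

Definition coin_prob (r : nat) (E : pred (r.-tuple bool)) : rat :=
  (#|E|%:R / (2 ^ r)%:R)%R.

(* With [p] passes, [A] outputs [answer G] with probability at least 2/3, for
   every simple digraph [G] on n nodes with independence number at most [alpha]
   and every arrival order of its arcs. *)
Definition computes (n alpha p r s : nat)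
    (A : rand_stream_alg r ('I_n * 'I_n) s)
    (answer : rel 'I_n -> seq bool) : Prop :=
  forall (G : rel 'I_n) (sigma : seq ('I_n * 'I_n)),
    irreflexive G -> independence_number G <= alpha -> is_stream G sigma ->
    (2%:R / 3%:R <= coin_prob [pred w | output (A w) p sigma == answer G])%R.

Definition reachability_answer (n : nat) (q : n.-tuple ('I_n * 'I_n))
    (G : rel 'I_n) : seq bool :=
  [seq connect G uv.1 uv.2 | uv <- q].

(* The query pairs are available to the algorithm from the start, for free. *)
Definition solves_n_pair_reachability (n alpha p r s : nat)
    (A : n.-tuple ('I_n * 'I_n) -> rand_stream_alg r ('I_n * 'I_n) s) : Prop :=
  forall q : n.-tuple ('I_n * 'I_n),
    computes alpha p (A q) (reachability_answer q).

Definition solves_triangle_detection (n alpha p r s : nat)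
    (A : rand_stream_alg r ('I_n * 'I_n) s) : Prop :=
  computes alpha p A (fun G => [:: has_directed_triangle G]).

(* Main.v *)
Require Import Defs.
From HB Require Import structures.
From mathcomp Require Import all_boot all_order all_algebra.
From mathcomp Require Import zify lra.

Set Implicit Arguments.
Unset Strict Implicit.
Unset Printing Implicit Defensive.

(* Giving the first half of the stream to one player and the second half to another
   turns a p-pass algorithm into a protocol exchanging 2ps bits, and block graphs
   encode a disjointness instance on Omega(alpha n) elements, so it suffices to
   bound randomized disjointness.

   Acceptance probabilities are nonnegative combinations of rectangles C x D, with
   total weight at most (number of transcripts) x (ways to share the output).  For
   a rectangle, compare, over splittings of the ground set into T, U and a point i
   with |T| = |U|, the pairs x in T, y in U with the pairs i + x, i + y meeting
   only in i.  For fixed S = T + i, either few x in C lie in S, or few points i of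
   S belong to less than 1/8 of those x; hence a rectangle with many disjoint pairs
   has a constant fraction as many meeting pairs, up to an exponentially small
   error.  Powers of the acceptance probability are again combinations of
   rectangles, which amplifies the gap beyond that constant. *)

(** * Small families of sets *)

Section Concentration.
Variable V : finType.
Implicit Types (S T J x y : {set V}) (C : {set {set V}}).

(** Expand a product over the points: a point of [S] is inside [x] with weight 1 or outside with
    weight 3 in [J] and 1 elsewhere, hence a factor 4 on [J] and 2 on the rest of [S]. *)
Lemma sum_subset_exp3 S J : J \subset S ->
  \sum_(x : {set V} | x \subset S) 3 ^ #|J :\: x| = 2 ^ (#|S| + #|J|).
Proof.
move=> JS; transitivity
  (\prod_(i : V) ((i \in S : nat) + (if i \in J then 3 else 1))).
  rewrite bigA_distr [RHS](bigID (fun x : {set V} => x \subset S)) /=.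
  rewrite [X in _ = _ + X]big1 ?addn0 => [|x /subsetPn[i xi Si]]; last first.
    by rewrite (bigD1 i) //= xi (negbTE Si).
  apply: eq_bigr => x /subsetP xS.
  rewrite -prod_nat_const big_mkcond; apply: eq_bigr => i _.
  by rewrite inE; case: (boolP (i \in x)) => //= /xS ->.
rewrite (bigID (mem S)) /= [X in _ * X]big1 ?muln1; last first.
  by move=> i Si; rewrite (negbTE Si) ifF //; apply: contraNF Si; apply/subsetP.
rewrite (big_setID J) /= (setIidPr JS).
have -> : \prod_(i in J) ((i \in S : nat) + (if i \in J then 3 else 1)) = 4 ^ #|J|.
  by rewrite -prod_nat_const; apply: eq_bigr => i iJ; rewrite iJ (subsetP JS).
have -> : \prod_(i in S :\: J) ((i \in S : nat) + (if i \in J then 3 else 1))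
          = 2 ^ (#|S| - #|J|).
  rewrite -cardsDS // -prod_nat_const; apply: eq_bigr => i.
  by rewrite inE => /andP[/negbTE -> ->].
rewrite (_ : 4 ^ #|J| = 2 ^ (2 * #|J|)) ?expnM // -expnM -expnD; congr (2 ^ _).
by have := subset_leq_card JS; lia.
Qed.

(* Markov: half of the family meets J in at most |J| / 4 points, and such
   subsets are exponentially rare, as the weights 3 ^ |J \ x| show. *)
Lemma light_family_small S J C b :
  {in C, forall x, x \subset S} -> J \subset S ->
  8 * (\sum_(x in C) #|x :&: J|) <= #|J| * #|C| -> 8 * b <= #|J| ->
  #|C| * 2 ^ b <= 2 ^ #|S|.+1.
Proof.
move=> CS JS light bJ; set j := #|J| in light bJ *.
have [j0|j_gt0] := posnP j.
  have -> : b = 0 by lia.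
  rewrite muln1 (@leq_trans (2 ^ #|S|)) ?leq_exp2l // -card_powerset.
  by apply/subset_leq_card/subsetP => x /CS; rewrite inE.
pose C' := [set x in C | 4 * #|x :&: J| <= j].
have half : #|C| <= 2 * #|C'|.
  have C'C : C' \subset C by apply/subsetP => x; rewrite inE => /andP[].
  have : j * #|C :\: C'| <= 4 * \sum_(x in C) #|x :&: J|.
    rewrite (big_setID C') /= mulnDr [_ * #|_|]mulnC -sum_nat_const.
    apply: leq_trans (leq_addl _ _); rewrite big_distrr /=.
    apply: leq_sum => x; rewrite !inE => /andP[+ xC].
    by rewrite xC /= -ltnNge => /ltnW.
  rewrite cardsDS // => h.
  have : j * (2 * (#|C| - #|C'|)) <= j * #|C| by lia.
  by rewrite leq_pmul2l //; lia.
(* This is 3j/4 rounded up; each member of [C'] misses at least [e] points of [J]. *)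
pose e := (3 * j + 3) %/ 4.
have heavy : #|C'| * 3 ^ e <= 2 ^ (#|S| + j).
  rewrite -(sum_subset_exp3 JS) -sum_nat_const.
  rewrite [X in _ <= X](bigID (mem C')) /=.
  apply: leq_trans (leq_addr _ _).
  have -> : \sum_(i : {set V} | (i \subset S) && (i \in C')) 3 ^ #|J :\: i|
          = \sum_(i in C') 3 ^ #|J :\: i|.
    apply: eq_bigl => x; case: (boolP (x \in C')); rewrite ?andbF // inE.
    by case/andP => /CS ->.
  apply: leq_sum => x; rewrite inE => /andP[_ xJ]; rewrite leq_exp2l //.
  have := cardsID x J; rewrite setIC -/j /e; lia.
(* After taking eighth powers, 8b <= j and 4e >= 3j reduce this to 2 ^ 9 <= 3 ^ 6. *)
have exps : 2 ^ (j + b) <= 3 ^ e.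
  rewrite -(@leq_exp2r _ _ 8) // -!expnM.
  apply: (@leq_trans (2 ^ (9 * j))); first by rewrite leq_exp2l //; lia.
  apply: (@leq_trans (3 ^ (6 * j))); last by rewrite leq_exp2l // /e; lia.
  by rewrite !expnM leq_exp2r.
have : #|C'| * 2 ^ b * 2 ^ j <= 2 ^ #|S| * 2 ^ j.
  rewrite -mulnA -!expnD (addnC b) (leq_trans _ heavy) //.
  by rewrite leq_mul2l exps orbT.
rewrite leq_pmul2r ?expn_gt0 // expnS => h.
by apply: leq_trans (leq_mul half (leqnn _)) _; rewrite -mulnA leq_mul2l.
Qed.

Definition nsub (C : pred {set V}) T : nat :=
  #|[set x : {set V} | (x \subset T) && C x]|.

Lemma nsub_le (C : pred {set V}) T : nsub C T <= 2 ^ #|T|.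
Proof.
rewrite -card_powerset; apply/subset_leq_card/subsetP => x.
by rewrite !inE => /andP[].
Qed.

Lemma nsub_without (C : pred {set V}) S i :
  nsub C (S :\ i) = #|[set x : {set V} | (x \subset S) && C x & i \notin x]|.
Proof. by apply: eq_card => x; rewrite !inE subsetD1 -!andbA [C x && _]andbC. Qed.

Lemma nsub_with (C : pred {set V}) S i : i \in S ->
  nsub (fun x => C (i |: x)) (S :\ i)
    = #|[set x : {set V} | (x \subset S) && C x & i \in x]|.
Proof.
move=> iS; rewrite /nsub -(@card_in_imset _ _ (fun x => i |: x)); last first.
  move=> x y; rewrite !inE !subsetD1 => /andP[/andP[_ ix] _] /andP[/andP[_ iy] _].
  by move=> /(congr1 (fun z => z :\ i)); rewrite !setU1K.
apply: eq_card => x; rewrite !inE; apply/imsetP/idP.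
  move=> [y]; rewrite inE subsetD1 => /andP[/andP[yS _] Cy] ->.
  by rewrite subUset sub1set iS yS Cy setU11.
case/andP=> /andP[xS Cx] ix; exists (x :\ i); rewrite ?setD1K //.
by rewrite inE setSD // setD1K.
Qed.

Lemma nsub_split (C : pred {set V}) S i : i \in S ->
  nsub C S = nsub C (S :\ i) + nsub (fun x => C (i |: x)) (S :\ i).
Proof.
move=> iS; rewrite nsub_without nsub_with // addnC /nsub.
rewrite -(cardsID [set x : {set V} | i \in x]); congr (_ + _).
  by apply: eq_card => x; rewrite !inE.
by apply: eq_card => x; rewrite !inE andbC.
Qed.

Lemma nsub_compl (C : pred {set V}) S :
  nsub (fun x => C (S :\: x)) S = nsub C S.
Proof.
rewrite /nsub -(@card_in_imset _ _ (fun x => S :\: x)); last first.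
  move=> x y; rewrite !inE => /andP[xS _] /andP[yS _] /(congr1 (fun z => S :\: z)).
  by rewrite !setDDr !setDv !set0U (setIidPr xS) (setIidPr yS).
apply: eq_card => x; rewrite !inE; apply/imsetP/idP.
  by move=> [y]; rewrite inE => /andP[yS Cy] ->; rewrite subsetDl.
case/andP=> xS Cx; exists (S :\: x); rewrite ?inE ?subsetDl /=;
  by rewrite setDDr setDv set0U (setIidPr xS).
Qed.

Lemma sum_card_setI C J :
  \sum_(x in C) #|x :&: J| = \sum_(i in J) #|[set x in C | i \in x]|.
Proof.
under eq_bigr do rewrite -sum1_card.
under [RHS]eq_bigr do rewrite -sum1_card.
rewrite (exchange_big_dep (mem J)) /= => [|x i _]; last by rewrite inE => /andP[].
apply: eq_bigr => i iJ; apply: eq_bigl => x.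
by rewrite !inE iJ andbT.
Qed.

(** By [nsub_split], for [i] outside [T]: less than 1/8 of the members of [C] inside [i |: T]
    contain [i]. *)
Definition rare (C : pred {set V}) T i : bool :=
  7 * nsub (fun x => C (i |: x)) T < nsub C T.

(** By double counting, members inside [S] contain on average at most 1/8 of the rare points; with
    8b rare points, [light_family_small] would apply. *)
Lemma rare_elements_few (C : pred {set V}) S b :
  2 ^ #|S|.+1 < nsub C S * 2 ^ b ->
  #|[set i in S | rare C (S :\ i) i]| < 8 * b.
Proof.
set J := [set _ in _ | _] => big; rewrite ltnNge; apply/negP => bJ.
move: big; rewrite ltnNge => /negP; apply.
have JS : J \subset S by apply/subsetP => i; rewrite inE => /andP[].
apply: (light_family_small _ JS _ bJ) => [x|]; first by rewrite inE => /andP[].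
rewrite sum_card_setI big_distrr /= -/(nsub C S) -sum_nat_const.
apply: leq_sum => i; rewrite inE /rare => /andP[iS].
have := nsub_with C iS; rewrite (nsub_split C iS).
set A := [set x | _ & _]; set B := [set x in _ | _].
have -> : A = B by apply/setP => x; rewrite !inE.
by move=> <-; lia.

Qed.

(** The sum counts the points of [S] missed by the members. If it were smaller, the complements in
    [S] would be a light family for [J = S]. *)
Lemma nsub_delete_sum (C : pred {set V}) S b : 8 * b <= #|S| ->
  2 ^ #|S|.+1 < nsub C S * 2 ^ b ->
  #|S| * nsub C S <= 8 * \sum_(i in S) nsub C (S :\ i).
Proof.
move=> bS big; rewrite leqNgt; apply/negP => few.
move: big; rewrite ltnNge => /negP; apply.
rewrite -nsub_compl; apply: (light_family_small _ (subxx S) _ bS) => [x|].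
  by rewrite inE => /andP[].
rewrite -/(nsub _ S) nsub_compl; apply: leq_trans (ltnW few).
rewrite leq_mul2l /= sum_card_setI; apply: leq_sum => i iS.
rewrite nsub_without; set D := [set x in _ | _].
rewrite -(@card_in_imset _ _ (fun x => S :\: x) D); last first.
  move=> x y; rewrite !inE => /andP[/andP[xS _] _] /andP[/andP[yS _] _].
  move=> /(congr1 (fun z => S :\: z)).
  by rewrite !setDDr !setDv !set0U (setIidPr xS) (setIidPr yS).
apply/subset_leq_card/subsetP => x /imsetP[y].
by rewrite !inE => /andP[/andP[yS Cy] iy] ->; rewrite subsetDl Cy !inE iy.
Qed.

(** For a large family there are at most 8b = |S|/32 rare points, and [nsub_delete_sum] gives
    average density at least 1/8, so rare points carry at most a quarter of the weight. The last
    term pays for small families. *)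
Lemma rare_weight (C : pred {set V}) S b : #|S| = 256 * b ->
  4 * 2 ^ b * (\sum_(i in S | rare C (S :\ i) i) nsub C (S :\ i)) <=
  2 ^ b * (\sum_(i in S) nsub C (S :\ i)) + 4 * #|S| * 2 ^ #|S|.+1.
Proof.
move=> cS; set R := \sum_(i in S | _) _.
have le_del i : i \in S -> nsub C (S :\ i) <= nsub C S.
  by move=> iS; rewrite (nsub_split C iS) leq_addr.
case: (leqP (nsub C S * 2 ^ b) (2 ^ #|S|.+1)) => [small|big].
  have : R <= #|S| * nsub C S.
    apply: (@leq_trans (\sum_(i in S) nsub C (S :\ i))).
      by rewrite [X in _ <= X](bigID (fun i => rare C (S :\ i) i)) leq_addr.
    by rewrite -sum_nat_const; apply: leq_sum.
  move=> h; apply: (@leq_trans (4 * #|S| * (nsub C S * 2 ^ b))).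
    by rewrite -!mulnA leq_mul2l /= mulnA [_ * 2 ^ b]mulnC leq_mul2l h orbT.
  by apply: leq_trans (leq_addl _ _); rewrite leq_mul2l small orbT.
apply: leq_trans (leq_addr _ _).
rewrite [4 * _]mulnC -mulnA leq_mul2l expn_eq0 /=.
have few := rare_elements_few big.
have dense : #|S| * nsub C S <= 8 * \sum_(i in S) nsub C (S :\ i).
  by apply: nsub_delete_sum big; lia.
have : R <= #|[set i in S | rare C (S :\ i) i]| * nsub C S.
  rewrite -sum_nat_const /R.
  rewrite [X in X <= _](eq_bigl (mem [set i in S | rare C (S :\ i) i])).
    by apply: leq_sum => i; case/setIdP => /le_del.
  by move=> i; rewrite /= inE.
move=> hR; have := leq_mul (ltnW few) (leqnn (nsub C S)).
move: dense; rewrite cS; set f := nsub C S in hR *; lia.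
Qed.

End Concentration.

(** * Corruption bound for rectangles *)

Section Corruption.
Variables (V : finType) (m b : nat).
Hypotheses (cardV : #|V| = m.*2.+1) (mb : m.+1 = 256 * b).
Implicit Types (S T x y : {set V}) (C D : pred {set V}).

(** A set [T] with a point [i] outside it amounts to [S = i |: T] with [i] marked; the complement of
    [S] is then constant in the inner sum. *)
Lemma sum_mark_delete (h : {set V} -> V -> nat) :
  \sum_(T : {set V} | #|T| == m) \sum_(i | i \notin T) h T i =
  \sum_(S : {set V} | #|S| == m.+1) \sum_(i in S) h (S :\ i) i.
Proof.
rewrite !pair_big_dep /=.
rewrite (reindex_onto (fun p : {set V} * V => (p.1 :\ p.2, p.2))
                      (fun p => (p.2 |: p.1, p.2))) /=; last first.
  by move=> [T i] /= /andP[_ iT]; rewrite setU1K.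
apply: eq_bigl => -[S i] /=; rewrite xpair_eqE eqxx andbT setD11 andbT.
have [iS|iS] := boolP (i \in S).
  by rewrite setD1K // eqxx !andbT (cardsD1 i S) iS.
rewrite andbF; apply/negP => /andP[_ /eqP e].
by move: iS; rewrite -e setU11.
Qed.

Definition ntriple : nat := \sum_(T : {set V} | #|T| == m) \sum_(i | i \notin T) 1.

Lemma ntriple_eq : ntriple = \sum_(S : {set V} | #|S| == m.+1) m.+1.
Proof.
rewrite /ntriple sum_mark_delete; apply: eq_bigr => S /eqP <-.
by rewrite sum1_card.
Qed.

Lemma cardC_marked S : #|S| = m -> #|~: S| = m.+1.
Proof. by move=> cS; rewrite cardsCs setCK cardV cS; lia. Qed.

Lemma rare_weight_scaled C S w : #|S| = m.+1 -> w <= 2 ^ m ->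
  4 * 2 ^ b * (w * \sum_(i in S | rare C (S :\ i) i) nsub C (S :\ i)) <=
  2 ^ b * (w * \sum_(i in S) nsub C (S :\ i)) + 16 * m.+1 * 4 ^ m.
Proof.
move=> cS hw; have cS' : #|S| = 256 * b by rewrite cS.
have := leq_mul (leqnn w) (rare_weight C cS'); rewrite cS => h.
rewrite mulnCA; apply: leq_trans h _; rewrite mulnDr mulnCA leq_add2l.
have -> : 16 * m.+1 * 4 ^ m = 2 ^ m * (4 * m.+1 * 2 ^ m.+2).
  by rewrite !expnS (expnMn 2 2 m : 4 ^ m = 2 ^ m * 2 ^ m); lia.
by rewrite leq_mul2r hw orbT.
Qed.

(** Where [i] is rare on neither side, each count is at most 7 times the count with [i] added, hence
    49. The rare part of each side is at most Z/4 plus an error; absorbing Z/2 turns 49 into 98. *)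
Lemma rectangle_corruption C D :
  2 ^ b * (\sum_(T : {set V} | #|T| == m) \sum_(i | i \notin T)
             nsub C T * nsub D (~: (i |: T))) <=
  98 * 2 ^ b * (\sum_(T : {set V} | #|T| == m) \sum_(i | i \notin T)
    nsub (fun x => C (i |: x)) T * nsub (fun y => D (i |: y)) (~: (i |: T)))
  + 16 * ntriple * 4 ^ m.
Proof.
set Z := \sum_(T : {set V} | _) _; set Q := \sum_(T : {set V} | _) _.
pose badC := \sum_(T : {set V} | #|T| == m) \sum_(i | i \notin T)
  (if rare C T i then nsub C T * nsub D (~: (i |: T)) else 0).
pose badD := \sum_(T : {set V} | #|T| == m) \sum_(i | i \notin T)
  (if rare D (~: (i |: T)) i then nsub C T * nsub D (~: (i |: T)) else 0).
have split_bad : Z <= 49 * Q + badC + badD.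
  rewrite /Z /Q /badC /badD big_distrr -!big_split /=.
  apply: leq_sum => T _; rewrite big_distrr -!big_split /=.
  apply: leq_sum => i _; rewrite /rare.
  case: ltnP => [_|hC]; first by rewrite -addnA addnCA leq_addr.
  case: ltnP => [_|hD]; first by rewrite leq_addl.
  by rewrite !addn0; have := leq_mul hC hD; lia.
(* Group by [S = i |: T], so that the factor from [D] is constant. *)
have bound_C : 4 * 2 ^ b * badC <= 2 ^ b * Z + 16 * ntriple * 4 ^ m.
  rewrite ntriple_eq /badC /Z !sum_mark_delete !big_distrr big_distrl -big_split /=.
  apply: leq_sum => S /eqP cS.
  have wS : nsub D (~: S) <= 2 ^ m.
    apply: leq_trans (nsub_le _ _) _; rewrite leq_exp2l //.
    by have := cardsC S; rewrite cS cardV; lia.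
  apply: leq_trans (leq_trans (rare_weight_scaled C cS wS) _); last first.
    rewrite leq_add2r leq_mul2l expn_eq0 /= big_distrr leq_eqVlt /=.
    by apply/orP; left; apply/eqP/eq_bigr => i iS; rewrite setD1K // mulnC.
  rewrite -big_mkcondr leq_mul2l /= big_distrr leq_eqVlt /=; apply/orP; right.
  by apply/orP; left; apply/eqP/eq_bigr => i /andP[iS _]; rewrite setD1K // mulnC.
(* Here [T] is fixed and its complement plays the part of [S]. *)
have bound_D : 4 * 2 ^ b * badD <= 2 ^ b * Z + 16 * ntriple * 4 ^ m.
  have -> : ntriple = \sum_(T : {set V} | #|T| == m) m.+1.
    apply: eq_bigr => T /eqP cT; rewrite -(cardC_marked cT) -sum1_card.
    by apply: eq_bigl => i; rewrite inE.
  rewrite /badD /Z !big_distrr big_distrl -big_split /=.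
  apply: leq_sum => T /eqP cT.
  have UE i : ~: (i |: T) = ~: T :\ i.
    by apply/setP => k; rewrite !inE negb_or.
  have wT : nsub C T <= 2 ^ m by rewrite -cT nsub_le.
  apply: leq_trans (leq_trans (rare_weight_scaled D (cardC_marked cT) wT) _);
    last first.
    rewrite leq_add2r leq_mul2l expn_eq0 /= big_distrr leq_eqVlt /=.
    apply/orP; left; apply/eqP; apply: eq_big => i; first by rewrite inE.
    by rewrite UE.
  rewrite -big_mkcondr leq_mul2l /= big_distrr leq_eqVlt /=; apply/orP; right.
  apply/orP; left; apply/eqP; apply: eq_big => i; first by rewrite inE UE.
  by rewrite UE.
move: split_bad bound_C bound_D; set t := 2 ^ b; set M := _ * 4 ^ m => h hC hD.
by have := leq_mul (leqnn t) h; lia.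
Qed.

End Corruption.

(** * Disjointness *)

Import Order.TTheory GRing.Theory Num.Theory.

Section RectangleCombinations.
Local Open Scope ring_scope.
Variables X Y : Type.
Implicit Types (L c : rat) (P : X -> Y -> rat).

(** [L] is an upper bound on the total weight. The last constructor relaxes it and replaces
    functional extensionality. *)
Inductive rect_comb : rat -> (X -> Y -> rat) -> Prop :=
| RectComb1 (a : pred X) (b : pred Y) : rect_comb 1 (fun x y => (a x && b y)%:R)
| RectCombD L1 P1 L2 P2 : rect_comb L1 P1 -> rect_comb L2 P2 ->
    rect_comb (L1 + L2) (fun x y => P1 x y + P2 x y)
| RectCombZ c L P : 0 <= c -> rect_comb L P ->
    rect_comb (c * L) (fun x y => c * P x y)
| RectCombW L1 L2 P1 P2 : L1 <= L2 -> P1 =2 P2 -> rect_comb L1 P1 ->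
    rect_comb L2 P2.

Lemma rect_comb_ge0 L P : rect_comb L P -> 0 <= L.
Proof.
elim=> // [L1 P1 L2 P2 _ ? _ ?|c L1 P1 ? _ ?|L1 L2 P1 P2 ? _ _ ?].
- exact: addr_ge0.
- exact: mulr_ge0.
- lra.
Qed.

Lemma rect_combM L1 P1 L2 P2 : rect_comb L1 P1 -> rect_comb L2 P2 ->
  rect_comb (L1 * L2) (fun x y => P1 x y * P2 x y).
Proof.
move=> h1 h2; have L2_ge0 := rect_comb_ge0 h2.
elim: h1 => [a b|L P L' P' _ IH _ IH'|c L P c0 _ IH|L L' P P' LL' PP' _ IH].
- elim: h2 => [a' b'|L P L' P' _ IH _ IH'|c L P c0 _ IH|L L' P P' LL' PP' _ IH].
  + apply: RectCombW (RectComb1 (predI a a') (predI b b')); first by rewrite mulr1.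
    by move=> x y /=; rewrite -natrM mulnb andbACA.
  + apply: RectCombW (RectCombD IH IH'); first by rewrite mulrDr.
    by move=> x y /=; rewrite mulrDr.
  + apply: RectCombW (RectCombZ c0 IH); first by rewrite mulrCA.
    by move=> x y /=; rewrite mulrCA.
  + apply: RectCombW IH; first by rewrite !mul1r.
    by move=> x y /=; rewrite PP'.
- apply: RectCombW (RectCombD IH IH'); first by rewrite mulrDl.
  by move=> x y /=; rewrite mulrDl.
- apply: RectCombW (RectCombZ c0 IH); first by rewrite mulrA.
  by move=> x y /=; rewrite mulrA.
- apply: RectCombW IH; first by rewrite ler_wpM2r.
  by move=> x y /=; rewrite PP'.
Qed.

Lemma rect_combX k L P : rect_comb L P ->
  rect_comb (L ^+ k) (fun x y => P x y ^+ k).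
Proof.
move=> h; elim: k => [|k IH].
  by apply: RectCombW (RectComb1 xpredT xpredT); rewrite ?expr0.
apply: RectCombW (rect_combM h IH); first by rewrite exprS.
by move=> x y /=; rewrite exprS.
Qed.

Lemma rect_comb_sum (I : finType) (L : I -> rat) (P : I -> X -> Y -> rat) :
  (forall i, rect_comb (L i) (P i)) ->
  rect_comb (\sum_i L i) (fun x y => \sum_i P i x y).
Proof.
move=> h; elim: (index_enum I) => [|i s IH].
  apply: RectCombW (RectCombZ (lexx 0) (RectComb1 xpredT xpredT)).
    by rewrite big_nil mul0r.
  by move=> x y /=; rewrite big_nil mul0r.
apply: RectCombW (RectCombD (h i) IH); first by rewrite big_cons.
by move=> x y /=; rewrite big_cons.
Qed.

End RectangleCombinations.

Section Disjointness.
Local Open Scope ring_scope.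
Variables (V : finType) (m b : nat).
Hypotheses (cardV : #|V| = m.*2.+1) (mb : m.+1 = (256 * b)%N).
Implicit Types (T U x y : {set V}) (P : {set V} -> {set V} -> rat).

(* Sum over the ways to split V into T, U and a point i with |T| = |U| = m,
   and over the subsets x of T and y of U. *)
Definition triple_sum (h : V -> {set V} -> {set V} -> rat) : rat :=
  \sum_(T : {set V} | #|T| == m) \sum_(i | i \notin T)
    \sum_(x : {set V} | x \subset T) \sum_(y : {set V} | y \subset ~: (i |: T))
      h i x y.

Lemma eq_triple_sum h1 h2 : (forall i x y, h1 i x y = h2 i x y) ->
  triple_sum h1 = triple_sum h2.
Proof. by move=> e; do 4!apply: eq_bigr => ? _. Qed.

Lemma triple_sumD h1 h2 :
  triple_sum (fun i x y => h1 i x y + h2 i x y) = triple_sum h1 + triple_sum h2.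
Proof. by rewrite -big_split; do 3!(apply: eq_bigr => ? _; rewrite -big_split). Qed.

Lemma triple_sumZ c h :
  triple_sum (fun i x y => c * h i x y) = c * triple_sum h.
Proof. by rewrite big_distrr; do 3!(apply: eq_bigr => ? _; rewrite big_distrr). Qed.

Lemma ler_triple_sum h1 h2 :
  (forall T i x y, i \notin T -> x \subset T -> y \subset ~: (i |: T) ->
     h1 i x y <= h2 i x y) ->
  triple_sum h1 <= triple_sum h2.
Proof.
move=> le12; apply: ler_sum => T _; apply: ler_sum => i iT.
by apply: ler_sum => x xT; apply: ler_sum => y yT; apply: le12 xT yT.
Qed.

Lemma rectangle_sum (C D : pred {set V}) T U :
  \sum_(x : {set V} | x \subset T) \sum_(y : {set V} | y \subset U)
    (C x && D y)%:R = (nsub C T * nsub D U)%:R :> rat.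
Proof.
have sumE (E : pred {set V}) (W : {set V}) :
    (\sum_(x : {set V} | x \subset W) (E x : nat))%N = nsub E W.
  rewrite /nsub -sum1dep_card [RHS]big_mkcondr /=.
  by apply: eq_bigr => x _; case: (E x).
rewrite -!sumE big_distrl natr_sum /=; apply: eq_bigr => x _.
rewrite big_distrr natr_sum /=; apply: eq_bigr => y _.
by rewrite mulnb.
Qed.

Lemma triple_sum_const c : triple_sum (fun _ _ _ => c) = c * (ntriple V m * 4 ^ m)%:R.
Proof.
rewrite /ntriple big_distrl natr_sum mulr_sumr /=; apply: eq_bigr => T /eqP cT.
rewrite big_distrl natr_sum mulr_sumr /=; apply: eq_bigr => i iT.
have cU : #|~: (i |: T)| = m.
  by rewrite cardsCs setCK cardsU1 iT cT cardV; lia.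
have sumC (W : {set V}) : \sum_(x : {set V} | x \subset W) c = c *+ 2 ^ #|W|.
  rewrite sumr_const -card_powerset; congr (c *+ _).
  by apply: eq_card => x; rewrite !inE.
rewrite (eq_bigr (fun=> c *+ 2 ^ m)) => [|x _]; last by rewrite sumC cU.
rewrite sumrMnl sumC cT -mulrnA mul1n mulr_natr.
by rewrite (expnMn 2 2 m : (4 ^ m = 2 ^ m * 2 ^ m)%N).
Qed.

Lemma ntriple_gt0 : (0 < ntriple V m)%N.
Proof.
rewrite ntriple_eq sum_nat_cond_const muln_gt0 andbT.
by rewrite card_draws bin_gt0 cardV; lia.
Qed.

(** The inequality is linear in [(L, P)] and monotone in [L], so it extends from single
    rectangles. *)
Lemma rect_comb_corruption L P : rect_comb L P ->
  (2 ^ b)%:R * triple_sum (fun _ => P) <=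
  (98 * 2 ^ b)%:R * triple_sum (fun i x y => P (i |: x) (i |: y))
    + (16 * ntriple V m * 4 ^ m)%:R * L.
Proof.
elim=> [C D|L1 P1 L2 P2 _ IH1 _ IH2|c L1 P1 c0 _ IH|L1 L2 P1 P2 LL' PP' _ IH].
- rewrite mulr1 /triple_sum.
  under eq_bigr do under eq_bigr do rewrite rectangle_sum.
  under [X in _ <= _ * X + _]eq_bigr do under eq_bigr do
    rewrite (rectangle_sum (fun x => C (_ |: x)) (fun y => D (_ |: y))).
  have castE (h : {set V} -> V -> nat) :
      \sum_(T : {set V} | #|T| == m) \sum_(i | i \notin T) (h T i)%:R =
      (\sum_(T : {set V} | #|T| == m) \sum_(i | i \notin T) h T i)%:R :> rat.
    by rewrite natr_sum; apply: eq_bigr => T _; rewrite natr_sum.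
  rewrite !castE -!natrM -natrD ler_nat.
  exact: rectangle_corruption cardV mb C D.
- by rewrite !triple_sumD; lra.
- by rewrite !triple_sumZ; have := ler_wpM2l c0 IH; lra.
- have e1 : triple_sum (fun _ => P2) = triple_sum (fun _ => P1).
    by apply: eq_triple_sum => i x y; rewrite PP'.
  have e2 : triple_sum (fun i x y => P2 (i |: x) (i |: y))
          = triple_sum (fun i x y => P1 (i |: x) (i |: y)).
    by apply: eq_triple_sum => i x y; rewrite PP'.
  rewrite e1 e2; apply: le_trans IH _.
  by rewrite lerD2l ler_wpM2l.
Qed.

(** Subsets of [T] and [U] are disjoint, and adding [i] to both makes them meet: compare the two
    averages over all [M] terms. *)
Lemma disjointness_corruption L P p0 p1 : rect_comb L P ->
  (forall x y, [disjoint x & y] -> p0 <= P x y) ->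
  (forall x y, ~~ [disjoint x & y] -> P x y <= p1) ->
  (2 ^ b)%:R * p0 <= (98 * 2 ^ b)%:R * p1 + 16%:R * L.
Proof.
move=> PL hi lo; set M := (ntriple V m * 4 ^ m)%:R : rat.
have M_gt0 : 0 < M by rewrite ltr0n muln_gt0 ntriple_gt0 expn_gt0.
have hZ : p0 * M <= triple_sum (fun _ => P).
  rewrite -triple_sum_const; apply: ler_triple_sum => T i x y iT xT yT.
  apply: hi; rewrite -setI_eq0 -subset0; apply/subsetP => k.
  rewrite !inE => /andP[kx ky].
  by have := subsetP yT _ ky; rewrite !inE (subsetP xT _ kx) orbT.
have hQ : triple_sum (fun i x y => P (i |: x) (i |: y)) <= p1 * M.
  rewrite -triple_sum_const; apply: ler_triple_sum => T i x y iT xT yT.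
  apply: lo; rewrite -setI_eq0; apply/set0Pn; exists i.
  by rewrite !inE eqxx.
have := rect_comb_corruption PL; rewrite -mulnA natrM -/M => h.
rewrite -(ler_pM2r M_gt0) mulrDl.
have := ler_wpM2l (ler0n _ (2 ^ b)) hZ.
have := ler_wpM2l (ler0n _ (98 * 2 ^ b)) hQ.
lra.
Qed.

(* Taking the eighth power of P amplifies the ratio 2 between the acceptance
   probabilities to 2 ^ 8 > 98. *)
Lemma disjointness_lower_bound L P : rect_comb L%:R P ->
  (forall x y, 0 <= P x y) ->
  (forall x y, [disjoint x & y] -> 2%:R / 3%:R <= P x y) ->
  (forall x y, ~~ [disjoint x & y] -> P x y <= 1 / 3%:R) ->
  (2 ^ b <= (3 * L) ^ 8)%N.
Proof.
move=> PL P0 hi lo.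
have : (2 ^ b)%:R * (2%:R / 3%:R) ^+ 8 <=
       (98 * 2 ^ b)%:R * (1 / 3%:R) ^+ 8 + 16%:R * L%:R ^+ 8 :> rat.
  apply: disjointness_corruption (rect_combX 8 PL) _ _ => x y d.
    by rewrite lerXn2r ?nnegrE ?hi ?P0.
  by rewrite lerXn2r ?nnegrE ?lo ?P0.
(* Clearing 3 ^ 8 leaves (256 - 98) * 2 ^ b <= 16 * (3 * L) ^ 8. *)
rewrite -(ler_nat rat) natrM; set t := (2 ^ b)%:R.
have t0 : 0 <= t :> rat by apply: ler0n.
rewrite natrX natrM exprMn; lra.
Qed.

End Disjointness.

(** * From streams to protocols *)

Section Protocol.
Variables (X Y : Type) (S : finType).
Variables (hA : nat -> X -> S -> S * seq bool) (hB : nat -> Y -> S -> S * seq bool).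

Fixpoint talk (p k : nat) (mu : S) (x : X) (y : Y) : seq bool :=
  if p is p'.+1 then
    let a := hA k x mu in let c := hB k y a.1 in
    a.2 ++ c.2 ++ talk p' k.+1 c.1 x y
  else [::].

(* Fixing the numbers i and j of false bits written by each party makes the event
   a union of rectangles, one per transcript. *)
Fixpoint quiet (p k : nat) (mu : S) (i j : nat) (x : X) (y : Y) : bool :=
  if p is p'.+1 then
    let a := hA k x mu in let c := hB k y a.1 in
    [&& all negb a.2 && (size a.2 <= i), all negb c.2 && (size c.2 <= j)
      & quiet p' k.+1 c.1 (i - size a.2) (j - size c.2) x y]
  else (i == 0) && (j == 0).

Fixpoint talk_sizes (p k : nat) (mu : S) (x : X) (y : Y) : nat * nat :=
  if p is p'.+1 then
    let a := hA k x mu in let c := hB k y a.1 in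
    let t := talk_sizes p' k.+1 c.1 x y in
    (size a.2 + t.1, size c.2 + t.2)
  else (0, 0).

Lemma quietE p k mu i j x y : quiet p k mu i j x y =
  all negb (talk p k mu x y) && ((i, j) == talk_sizes p k mu x y).
Proof.
elim: p k mu i j => //= p IH k mu i j; rewrite IH !all_cat.
set a := hA _ _ _; set c := hB _ _ _.
case: (talk_sizes _ _ _ _ _) => t1 t2; rewrite !xpair_eqE /=.
case: (all _ a.2) => //=; case: (all _ c.2) => /=; last by rewrite andbF.
case: (all _ (talk _ _ _ _ _)) => /=; last by rewrite !andbF.
by apply/idP/idP; lia.
Qed.

Lemma size_talk p k mu x y : size (talk p k mu x y) =
  (talk_sizes p k mu x y).1 + (talk_sizes p k mu x y).2.
Proof. by elim: p k mu => //= p IH k mu; rewrite !size_cat IH; lia. Qed.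

Lemma eq_nseq_false (s : seq bool) l :
  (s == nseq l false) = all negb s && (size s == l).
Proof.
elim: s l => [|c s IH] [|l] //=; rewrite ?andbF //.
by rewrite eqseq_cons IH eqSS andbA; case: c.
Qed.

(** The [l] bits are shared between the parties in one definite way, so at most one term is 1. *)
Lemma talk_nseq_false p k mu x y l :
  (talk p k mu x y == nseq l false : nat) =
  \sum_(i < l.+1) (quiet p k mu i (l - i) x y : nat).
Proof.
rewrite eq_nseq_false size_talk; under eq_bigr do rewrite quietE.
case: (all _ _) => /=; last by rewrite big1.
case: (talk_sizes _ _ _ _ _) => t1 t2 /=; case: eqP => [<-|ne].
  have lt1 : t1 < (t1 + t2).+1 by lia.
  rewrite (bigD1 (Ordinal lt1)) //= addKn eqxx big1 // => i.
  by rewrite -val_eqE /= xpair_eqE => /negbTE ->.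
rewrite big1 // => i _; rewrite xpair_eqE.
by have := ltn_ord i; case: eqP; case: eqP => //; lia.
Qed.

(** The budgets are functions of the inputs because, with the states exchanged in a pass fixed, what
    remains of [i] depends on [x] alone and of [j] on [y] alone. Two states per pass give the factor
    [#|S| ^ 2]. *)
Lemma rect_comb_quiet p k mu (i : X -> nat) (j : Y -> nat) :
  rect_comb (((#|S| ^ 2) ^ p)%:R)%R
    (fun x y => (quiet p k mu (i x) (j y) x y)%:R%R).
Proof.
elim: p k mu i j => [|p IH] k mu i j.
  exact: RectComb1 (fun x => i x == 0) (fun y => j y == 0).
pose a (nu : S) x := let a := hA k x mu in
  [&& a.1 == nu, all negb a.2 & size a.2 <= i x].
pose c (nu mu' : S) y := let c := hB k y nu in
  [&& c.1 == mu', all negb c.2 & size c.2 <= j y].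
have h := rect_comb_sum (fun q : S * S => rect_combM
  (RectComb1 (a q.1) (c q.1 q.2))
  (IH k.+1 q.2 (fun x => i x - size (hA k x mu).2)
               (fun y => j y - size (hB k y q.1).2))).
apply: RectCombW h.
  by rewrite sumr_const card_prod mul1r -mulrnA mulnC mulnn -expnS.
move=> x y /=; set nu := (hA k x mu).1; set mu' := (hB k y nu).1.
rewrite (bigD1 (nu, mu')) //= big1 ?addr0 => [|[nu0 mu0] /= ne].
  by rewrite /a /c -/nu -/mu' !eqxx /= -natrM mulnb -andbA.
rewrite /a /c -/nu; case: eqP => [e|]; last by rewrite mul0r.
rewrite -e -/mu' in ne *; case: eqP => [e'|]; last by rewrite andbF mul0r.
by rewrite -e' eqxx in ne.
Qed.

Lemma rect_comb_talk p mu l :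
  rect_comb ((l.+1 * (#|S| ^ 2) ^ p)%:R)%R
    (fun x y => (talk p 0 mu x y == nseq l false)%:R%R).
Proof.
have h := rect_comb_sum (fun i : 'I_l.+1 =>
  rect_comb_quiet p 0 mu (fun=> i : nat) (fun=> l - i)).
apply: RectCombW h; first by rewrite sumr_const card_ord -mulrnA mulnC.
by move=> x y /=; rewrite talk_nseq_false natr_sum.
Qed.

End Protocol.

Section StreamToProtocol.
Variables (T : Type) (s : nat) (A : stream_alg T s).
Variables (X Y : Type) (sA : X -> seq T) (sB : Y -> seq T).

(** Each party starts from an empty tape, so it returns only the bits it writes itself. *)
Definition stepsA (k : nat) (x : X) (mu : s.-tuple bool) :=
  foldl (run_step A k) (mu, [::]) (sA x).

Definition stepsB (k : nat) (y : Y) (mu : s.-tuple bool) :=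
  run_pass A (sB y) (mu, [::]) k.

Lemma foldl_run_step_emit k (c : config s) sigma :
  foldl (run_step A k) c sigma =
  emit c.2 (foldl (run_step A k) (c.1, [::]) sigma).
Proof.
elim/last_ind: sigma => [|sigma a IH]; first by rewrite /emit /= cats0; case: c.
by rewrite !foldl_rcons IH /run_step /emit /= catA.
Qed.

Lemma run_pass_cat k x y (c : config s) :
  run_pass A (sA x ++ sB y) c k =
  let a := stepsA k x c.1 in let d := stepsB k y a.1 in
  (d.1, c.2 ++ a.2 ++ d.2).
Proof.
rewrite /run_pass foldl_cat foldl_run_step_emit.
rewrite [foldl _ c (sA x)]foldl_run_step_emit -/(stepsA k x c.1).
rewrite /stepsB /run_pass /emit /= !catA.
by [].
Qed.

Lemma output_talk p x y :
  output A p (sA x ++ sB y) = talk stepsA stepsB p 0 (alg_init A) x y.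
Proof.
rewrite /output /run.
suff gen k c : (foldl (run_pass A (sA x ++ sB y)) c (iota k p)).2 =
    c.2 ++ talk stepsA stepsB p k c.1 x y by rewrite gen.
elim: p k c => [|p IH] k c /=; first by rewrite cats0.
by rewrite IH run_pass_cat /= !catA.
Qed.

End StreamToProtocol.

Lemma coin_probE (r : nat) (E : pred (r.-tuple bool)) :
  coin_prob E = (((2 ^ r)%:R)^-1 * \sum_w (E w)%:R)%R.
Proof.
rewrite /coin_prob mulrC -sum1_card natr_sum big_mkcond /=; congr (_ * _)%R.
by apply: eq_bigr => w _; rewrite unfold_in; case: (E w).
Qed.

Section Reduction.
Variables (n alpha p r s b l : nat) (A : rand_stream_alg r ('I_n * 'I_n) s).
Variable answer : rel 'I_n -> seq bool.
Variable N : nat.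
Variable G : {set 'I_N} -> {set 'I_N} -> rel 'I_n.
Variables sA sB : {set 'I_N} -> seq ('I_n * 'I_n).

Lemma streaming_lower_bound :
  (N.+1 = 512 * b)%N ->
  (forall x y, irreflexive (G x y)) ->
  (forall x y, independence_number (G x y) <= alpha)%N ->
  (forall x y, is_stream (G x y) (sA x ++ sB y)) ->
  (forall x y, (answer (G x y) == nseq l false) = [disjoint x & y]) ->
  computes alpha p A answer ->
  (2 ^ b <= (3 * (l.+1 * 2 ^ (2 * s * p))) ^ 8)%N.
Proof.
move=> Nb irrG indG strG ansG corA.
pose P x y := coin_prob [pred w | output (A w) p (sA x ++ sB y) == nseq l false].
have Nm : N = ((256 * b).-1).*2.+1 by lia.
apply: (@disjointness_lower_bound 'I_N (256 * b).-1 b _ _ _ P).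
- by rewrite card_ord.
- by lia.
(* Averaging over the coins leaves the total weight of one deterministic protocol. *)
- have h := RectCombZ (c := ((2 ^ r)%:R)^-1%R) _ (rect_comb_sum
    (fun w : r.-tuple bool =>
      rect_comb_talk (stepsA (A w) sA) (stepsB (A w) sB) p (alg_init (A w)) l)).
  apply: RectCombW (h _); last by rewrite invr_ge0 ler0n.
    rewrite sumr_const !card_tuple card_bool -!expnM -mulrnA.
    rewrite (natrM _ _ (2 ^ r)) mulrCA.
    rewrite mulVf ?pnatr_eq0 -?lt0n ?expn_gt0 // mulr1 ler_nat.
    by rewrite [s * _]mulnCA mulnA.
  move=> x y /=; rewrite /P coin_probE; congr (_ * _)%R.
  by apply: eq_bigr => w _; rewrite /= output_talk.
- by move=> x y; rewrite /P /coin_prob divr_ge0.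
- move=> x y dxy; have := corA (G x y) _ (irrG x y) (indG x y) (strG x y).
  by have /eqP -> : answer (G x y) == nseq l false by rewrite ansG.
- move=> x y dxy; have := corA (G x y) _ (irrG x y) (indG x y) (strG x y).
  set E := [pred w | _ == answer _] => hE.
  (* For meeting sets the correct answer is not all false, so the two events exclude each other. *)
  have : (P x y + coin_prob E <= 1)%R.
    rewrite /P /coin_prob -mulrDl ler_pdivrMr ?ltr0n ?expn_gt0 // mul1r -natrD ler_nat.
    have -> : 2 ^ r = #|{: r.-tuple bool}| by rewrite card_tuple card_bool.
    rewrite -cardUI [X in (_ + X)%N]eq_card0 ?addn0 ?max_card // => w.
    rewrite !inE; apply/negP => /andP[/eqP -> /eqP e].
    by move: dxy; rewrite -ansG e eqxx.
  by lra.
Qed.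

End Reduction.

(** * Block graphs *)

Section BlockGraph.
Variables (n N a : nat) (dense : bool).
Hypothesis a_gt0 : 0 < a.
Implicit Types (x y : {set 'I_N}) (u v w k : nat).

Definition blk u := u %/ (3 * a).
Definition typ u := u %% (3 * a) %/ a.
Definition idx u := u %% a.
(** Numbers the triples (block, i, j); [u] is a_i or c_i and [v] is b_j. *)
Definition code u v := (blk u * a + idx u) * a + idx v.
(** Codes of [N] or more are legal and count as absent. *)
Definition bit x k := k \in [seq val i | i in x].

(* Blocks of 3a consecutive nodes a_i, b_j, c_i (types 0, 1, 2) are joined by
   all forward arcs.  Bit (i, j) of x is the arc a_i -> b_j and bit (i, j) of y
   is b_j -> c_i; in the dense variant absent bits are reversed arcs and there
   are arcs c_i -> a_i. *)
Definition arc x y u v : bool :=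
  if blk u < blk v then true else if blk v < blk u then false else
  match typ u, typ v with
  | 0, 1 => bit x (code u v)
  | 1, 0 => dense && ~~ bit x (code v u)
  | 1, 2 => bit y (code v u)
  | 2, 1 => dense && ~~ bit y (code u v)
  | 2, 0 => dense && (idx u == idx v)
  | _, _ => false
  end.

Definition block_graph x y : rel 'I_n := fun u v : 'I_n => arc x y u v.

Lemma typ_lt3 u : typ u < 3.
Proof. by rewrite /typ ltn_divLR // ltn_pmod // muln_gt0. Qed.

Lemma nodeE u : u = blk u * (3 * a) + typ u * a + idx u.
Proof.
rewrite {1}(divn_eq u (3 * a)) -addnA; congr (_ + _).
by rewrite {1}(divn_eq (u %% (3 * a)) a) modn_dvdm // dvdn_mull.
Qed.

Lemma node_inj u v : blk u = blk v -> typ u = typ v -> idx u = idx v -> u = v.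
Proof. by move=> hb ht hi; rewrite (nodeE u) (nodeE v) hb ht hi. Qed.

Lemma node_coords q t i : t < 3 -> i < a ->
  let u := q * (3 * a) + t * a + i in [/\ blk u = q, typ u = t & idx u = i].
Proof.
move=> t3 ia /=; have lt : t * a + i < 3 * a by nia.
rewrite /blk /typ /idx -addnA; split.
- by rewrite divnMDl ?muln_gt0 // divn_small ?addn0.
- by rewrite modnMDl (modn_small lt) divnMDl // divn_small ?addn0.
- by rewrite mulnCA mulnA addnA -mulnDl modnMDl modn_small.
Qed.

Lemma bitP x k : reflect (exists2 i : 'I_N, i \in x & k = i) (bit x k).
Proof. exact: (iffP imageP). Qed.

Lemma arc_irr x y u : arc x y u u = false.
Proof. by rewrite /arc ltnn; case: (typ u) => [|[|[|?]]]. Qed.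

Lemma arc_blk x y u v : arc x y u v -> blk u <= blk v.
Proof. by rewrite /arc; case: ltngtP. Qed.

(** The only pairs whose arcs may depend on [x]; both directions occur because of the reversed
    arcs. *)
Definition first_player u v : bool :=
  (blk u == blk v) && ((typ u, typ v) \in [:: (0, 1); (1, 0)]).

Lemma arc_first x y u v : first_player u v -> arc x y u v = arc x set0 u v.
Proof.
case/andP => /eqP e; rewrite /arc e ltnn !inE !xpair_eqE.
by case/orP => /andP[/eqP -> /eqP ->].
Qed.

Lemma arc_second x y u v : ~~ first_player u v -> arc x y u v = arc set0 y u v.
Proof.
rewrite /first_player /arc; case: ltngtP => //= _.
by case: (typ u) => [|[|[|?]]]; case: (typ v) => [|[|[|?]]].
Qed.

Definition first_stream x : seq ('I_n * 'I_n) :=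
  [seq e : 'I_n * 'I_n <- enum {: 'I_n * 'I_n}
    | first_player e.1 e.2 && arc x set0 e.1 e.2].
Definition second_stream y : seq ('I_n * 'I_n) :=
  [seq e : 'I_n * 'I_n <- enum {: 'I_n * 'I_n}
    | ~~ first_player e.1 e.2 && arc set0 y e.1 e.2].

Lemma block_stream x y :
  is_stream (block_graph x y) (first_stream x ++ second_stream y).
Proof.
split=> [|u v].
  have U := enum_uniq {: 'I_n * 'I_n}.
  rewrite cat_uniq !(filter_uniq _ U) andbT; apply/hasPn => e.
  by rewrite !mem_filter => /andP[/andP[/negbTE -> _] _].
rewrite mem_cat [_ \in first_stream x]mem_filter [_ \in second_stream y]mem_filter.
rewrite mem_enum inE !andbT /=.
case: (boolP (first_player u v)) => h /=; rewrite ?orbF.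
  by rewrite -(arc_first x y h).
by rewrite -(arc_second x y h).
Qed.

Lemma block_irreflexive x y : irreflexive (block_graph x y).
Proof. by move=> u; apply: arc_irr. Qed.

(** Nodes of different blocks are always adjacent. *)
Lemma independent_blk x y (S : {set 'I_n}) :
  independent (underlying (block_graph x y)) S ->
  {in S &, forall u v : 'I_n, blk u = blk v /\ ~~ arc x y u v}.
Proof.
move=> /'forall_in_forall_inP ind u v uS vS.
have /norP[uv vu] := ind u uS v vS; split=> //.
by move: uv vu; rewrite /block_graph /arc; case: (ltngtP (blk u) (blk v)).
Qed.

Lemma injective_independence x y M (g : 'I_n -> 'I_M) :
  (forall S : {set 'I_n}, independent (underlying (block_graph x y)) S ->
     {in S &, injective g}) ->
  independence_number (block_graph x y) <= M.
Proof.
move=> inj; apply/bigmax_leqP => S /inj gS.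
by rewrite -(card_in_imset gS) -[X in _ <= X]card_ord max_card.
Qed.

(** In a block a_i, b_i and c_i are pairwise adjacent, absent arcs being reversed, so an independent
    set has at most one node per index. *)
Lemma dense_independence x y : dense ->
  independence_number (block_graph x y) <= a.
Proof.
move=> den; pose g (u : 'I_n) : 'I_a := Ordinal (ltn_pmod u a_gt0).
apply: (injective_independence (g := g)) => S ind u v uS vS /(congr1 val) /= e.
have [ebl uv] := independent_blk ind uS vS.
have [_ vu] := independent_blk ind vS uS.
apply/val_inj/node_inj => //; move: uv vu; rewrite /arc ebl ltnn den /idx e eqxx.
have := typ_lt3 u; have := typ_lt3 v; rewrite /code ebl /idx e.
by case: (typ u) => [|[|[|?]]]; case: (typ v) => [|[|[|?]]] //= _ _; case: (bit _ _).
Qed.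

Lemma sparse_independence x y : independence_number (block_graph x y) <= 3 * a.
Proof.
have a3 : 0 < 3 * a by rewrite muln_gt0.
pose g (u : 'I_n) : 'I_(3 * a) := Ordinal (ltn_pmod u a3).
apply: (injective_independence (g := g)) => S ind u v uS vS /(congr1 val) /= e.
have [ebl _] := independent_blk ind uS vS; apply: val_inj => /=.
by rewrite (divn_eq u (3 * a)) (divn_eq v (3 * a)) e -/(blk u) ebl.
Qed.

Definition wedge u v w : Prop :=
  [/\ blk u = blk v, blk w = blk u, idx w = idx u &
      [/\ typ u = 0, typ v = 1 & typ w = 2]].

Lemma arc_wedge x y u v w : wedge u v w ->
  (arc x y u v = bit x (code u v)) * (arc x y v w = bit y (code u v)).
Proof.
case=> e1 e2 e3 [t0 t1 t2]; rewrite /arc e2 -e1 ltnn t0 t1 t2; split=> //.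
by rewrite /code e2 e3.
Qed.

Lemma wedge_meet x y u v w : wedge u v w ->
  arc x y u v -> arc x y v w -> ~~ [disjoint x & y].
Proof.
move=> wd; rewrite !(arc_wedge x y wd) => /bitP[i ix ei] /bitP[j jy ej].
rewrite -setI_eq0; apply/set0Pn; exists i; rewrite !inE ix.
by have -> : i = j by apply: val_inj; rewrite /= -ei.
Qed.

(** Dividing a common element by [a] twice inverts [code]; the bound on [N] puts its block among the
    complete ones. *)
Lemma meet_wedge x y : N <= n %/ (3 * a) * (a * a) -> ~~ [disjoint x & y] ->
  exists u v w : 'I_n, [/\ wedge u v w, w = u + 2 * a :> nat,
    arc x y u v & arc x y v w].
Proof.
move=> Nn; rewrite -setI_eq0 => /set0Pn[k]; rewrite inE => /andP[kx ky].
pose q := k %/ (a * a); pose i := k %/ a %% a; pose j := k %% a.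
have ia : i < a by apply: ltn_pmod.
have ja : j < a by apply: ltn_pmod.
have qn : q < n %/ (3 * a).
  by rewrite /q ltn_divLR ?muln_gt0 ?a_gt0 //; apply: leq_trans (ltn_ord k) Nn.
have bound t i' : t < 3 -> i' < a -> q * (3 * a) + t * a + i' < n.
  have := leq_trunc_div n (3 * a); have := leq_mul qn (leqnn (3 * a)); nia.
have [u1 u2 u3] := node_coords q (isT : 0 < 3) ia.
have [v1 v2 v3] := node_coords q (isT : 1 < 3) ja.
have [w1 w2 w3] := node_coords q (isT : 2 < 3) ia.
exists (Ordinal (bound 0 i isT ia)), (Ordinal (bound 1 j isT ja)).
exists (Ordinal (bound 2 i isT ia)).
set u := Ordinal _; set v := Ordinal _; set w := Ordinal _.
have wd : wedge u v w by split; rewrite /= ?u1 ?v1 ?w1 ?u3 ?w3.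
have kE : code u v = k.
  rewrite /code /= u1 u3 v3 /q divnMA -divn_eq /j -divn_eq //.
have kxb : bit x (code u v) by apply/bitP; exists k.
have kyb : bit y (code u v) by apply/bitP; exists k.
by split=> //; rewrite ?(arc_wedge x y wd) //= ; lia.
Qed.

(** A triangle cannot leave its block. No arc there joins equal types or goes from type 0 to type 2,
    so the types run 0, 1, 2 cyclically, and the arc back to type 0 equates the indices. *)
Lemma dense_triangle x y : dense -> N <= n %/ (3 * a) * (a * a) ->
  has_directed_triangle (block_graph x y) = ~~ [disjoint x & y].
Proof.
move=> den Nn; apply/idP/idP => [|/(meet_wedge Nn)[u [v [w [wd _ uv vw]]]]].
  case/existsP=> u /existsP[v /existsP[w /and3P[/= uv vw wu]]].
  have b1 := arc_blk uv; have b2 := arc_blk vw; have b3 := arc_blk wu.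
  have e1 : blk v = blk u by lia.
  have e2 : blk w = blk u by lia.
  have := typ_lt3 u; have := typ_lt3 v; have := typ_lt3 w.
  have key u' v' w' : blk v' = blk u' -> blk w' = blk u' ->
      typ u' = 0 -> typ v' = 1 -> typ w' = 2 ->
      arc x y u' v' -> arc x y v' w' -> arc x y w' u' -> ~~ [disjoint x & y].
    move=> f1 f2 t0 t1 t2 uv' vw' wu'; apply: (wedge_meet _ uv' vw').
    split=> //; move: wu'; rewrite /arc f2 ltnn t2 t0 => /andP[_ /eqP ->] //.
  case tu: (typ u) => [|[|[|?]]] //; case tv: (typ v) => [|[|[|?]]] //;
    case tw: (typ w) => [|[|[|?]]] // _ _ _;
    move: (uv) (vw) (wu); rewrite /block_graph /arc !e1 !e2 ltnn tu tv tw //= => _ _ _.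
  - by apply: (key u v w).
  - by apply: (key w u v) => //; lia.
  - by apply: (key v w u) => //; lia.
apply/existsP; exists u; apply/existsP; exists v; apply/existsP; exists w.
apply/and3P; split=> //; case: wd => e1 e2 e3 [t0 t1 t2].
by rewrite /block_graph /arc e2 ltnn t0 t2 den e3 eqxx.
Qed.

(* The pairs (a_i, c_i); nodes that are not some a_i repeat the pair of node 0. *)
Definition query (u0 w0 : 'I_n) (u : 'I_n) : 'I_n * 'I_n :=
  if (typ u == 0) && (u + 2 * a < n) then (u, insubd w0 (u + 2 * a)) else (u0, w0).

Section Reachability.
Variables (x y : {set 'I_N}) (u : 'I_n).
Hypotheses (typ_u : typ u = 0) (variant : ~~ dense || (a == 1)).

(* An invariant of paths from u: within a block, either no arc decreases the type
   or there is one node per type, so only wedges lead to type 2. *)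
Definition reached (z : 'I_n) : Prop :=
  blk u < blk z \/ blk z = blk u /\
  match typ z with
  | 0 => z = u
  | 1 => arc x y u z
  | _ => exists v : 'I_n, [/\ blk v = blk u, typ v = 1, arc x y u v & arc x y v z]
  end.

(** Arcs decreasing the type within a block need the dense variant; then [a] is 1 and they return to
    [u] or to the type 1 node already used. *)
Lemma reached_step z z' : reached z -> block_graph x y z z' -> reached z'.
Proof.
move=> rz zz'; have le := arc_blk zz'; rewrite /reached.
case: rz => [lt|[e rz]]; first by left; apply: leq_trans le.
have [lt|] := ltnP (blk u) (blk z'); first by left.
move=> ge; right; have e' : blk z' = blk u by lia.
have uniq_node (s t : 'I_n) : dense -> blk s = blk u -> blk t = blk u ->
    typ s = typ t -> s = t.
  move=> den es et est; apply/val_inj/node_inj => //; first by rewrite es et.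
  by move: variant; rewrite den /idx => /eqP ->; rewrite !modn1.
split=> //; have := typ_lt3 z; have := typ_lt3 z'.
move: (zz') rz; rewrite {1}/block_graph {1}/arc e e' ltnn.
case tz: (typ z) => [|[|[|?]]] //; case tz': (typ z') => [|[|[|?]]] //.
- by move=> _ zu _ _; rewrite -zu; apply: zz'.
- by case/andP=> den _ _ _ _; apply: uniq_node; rewrite ?typ_u.
- by move=> _ uz _ _; exists z.
- by case/andP=> den _ _ _ _; apply: uniq_node; rewrite ?typ_u.
- case/andP=> den _ [v [ev tv uv _]] _ _.
  by have -> : z' = v by apply: uniq_node; rewrite ?tv.
Qed.

Lemma connect_reached z : connect (block_graph x y) u z -> reached z.
Proof.
case/connectP=> s pth ->; have : reached u by right; rewrite typ_u.
suff gen (z0 : 'I_n) : path (block_graph x y) z0 s -> reached z0 -> reached (last z0 s).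
  exact: gen.
elim: s z0 {pth} => //= z' s IH z0 /andP[st pth] r0.
by apply: IH pth _; apply: reached_step st.
Qed.

Lemma connect_meet (w : 'I_n) : w = u + 2 * a :> nat ->
  connect (block_graph x y) u w -> ~~ [disjoint x & y].
Proof.
move=> ew /connect_reached.
have [w1 w2 w3] := node_coords (blk u) (isT : 2 < 3) (ltn_pmod u a_gt0).
have wE : w = blk u * (3 * a) + 2 * a + u %% a :> nat.
  by rewrite ew {1}(nodeE u) typ_u /idx; lia.
rewrite -wE in w1 w2 w3.
case=> [|[_]]; first by rewrite w1 ltnn.
rewrite w2 => -[v [ev tv uv vw]]; apply: (wedge_meet _ uv vw).
by split; rewrite ?ev ?w1.
Qed.

End Reachability.

Lemma block_reachability x y (u0 w0 : 'I_n) :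
  ~~ dense || (a == 1) -> N <= n %/ (3 * a) * (a * a) ->
  u0 = 0 :> nat -> w0 = 2 * a :> nat ->
  (reachability_answer [tuple query u0 w0 i | i < n] (block_graph x y)
     == nseq n false) = [disjoint x & y].
Proof.
move=> var Nn hu0 hw0.
rewrite eq_nseq_false size_map size_tuple eqxx andbT all_map.
apply/allP/idP => [none|dis _ /mapP[i _ ->] /=].
  apply/negPn/negP => /(meet_wedge Nn)[u [v [w [wd ew uv vw]]]].
  have hu : (u, w) \in [tuple query u0 w0 i | i < n].
    apply/mapP; exists u; first by rewrite mem_enum.
    case: wd => _ _ _ [tu _ _]; rewrite /query tu -ew ltn_ord /=.
    by congr pair; apply: val_inj; rewrite val_insubd ltn_ord.
  have /negP := none _ hu; apply; apply: (@connect_trans _ _ v); exact: connect1.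
apply: contraL dis; rewrite /query; case: ifP => [/andP[/eqP ti lt]|_] /=.
  by apply: connect_meet => //; rewrite val_insubd lt.
(* The default pair is itself a pair (a_i, c_i), so it too is unreachable for disjoint sets. *)
apply: connect_meet => //; last by rewrite hu0 hw0.
by rewrite hu0 /typ mod0n div0n.
Qed.

End BlockGraph.

(** * The lower bound *)

(** Absorbs the factor due to the output length into half of the exponent [b]. *)
Lemma exp2_dominates (H : nat) : exists b0, forall b, b0 <= b ->
  (3 * (H * b.+1).+1) ^ 8 <= 2 ^ (b %/ 2).
Proof.
have [E defE] : {E | E = 96 * H.+1} by exists (96 * H.+1).
(* Then 8E and 8u are each at most b/4. *)
exists (32 * E) => b bE; pose u := b %/ 32.
have le_base : 3 * (H * b.+1).+1 <= E * u.+1 by rewrite defE /u; nia.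
have le_pow : E * u.+1 <= 2 ^ (E + u).
  by rewrite expnD; apply: leq_mul; [apply/ltnW/ltn_expl | apply: ltn_expl].
apply: (@leq_trans ((2 ^ (E + u)) ^ 8)).
  by rewrite leq_exp2r // (leq_trans le_base).
by rewrite -expnM leq_exp2l //; move: bE; rewrite /u; lia.
Qed.

Lemma instance_parameters : exists K n0, 0 < K /\
  forall n alpha, n0 <= n -> 1 <= alpha <= n ->
  exists a b, [/\ 0 < a, a <= alpha, (a == 1) || (3 * a <= alpha), 3 * a <= n &
    [/\ 0 < b, 512 * b <= (n %/ (3 * a) * (a * a)).+1 &
      forall p s l, l <= n -> 2 ^ b <= (3 * (l.+1 * 2 ^ (2 * s * p))) ^ 8 ->
        alpha * n <= K * (s * p)]].
Proof.
(* 30 = 5 * 6 comes from alpha <= 5a and n <= 6at, and 512 from the definition of [b]. *)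
have [H defH] : {H | H = 30 * 512} by exists (30 * 512).
have [b0 hb0] := exp2_dominates H.
(* 64 = 2 * 32 comes from b + 1 <= 2b and b <= 32sp; the threshold on [n] forces b > b0. *)
exists (64 * H), (H * b0.+2); split; first by rewrite defH.
move=> n alpha n_ge /andP[al_gt0 al_le].
pose a := maxn 1 (alpha %/ 3); pose t := n %/ (3 * a).
pose b := (t * (a * a)).+1 %/ 512.
have n3 : 3 <= n by move: n_ge; rewrite defH; lia.
have a_gt0 : 0 < a by rewrite /a; lia.
have a3n : 3 * a <= n by rewrite /a; lia.
have al5 : alpha <= 5 * a by rewrite /a; lia.
have t_gt0 : 0 < t by rewrite /t divn_gt0 ?muln_gt0.
have n6 : n <= 6 * a * t.
  have := ltn_ceil n (_ : 0 < 3 * a); rewrite muln_gt0 a_gt0 -/t => /(_ isT).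
  by nia.
have size_le : alpha * n <= H * b.+1.
  have : alpha * n <= 30 * (t * (a * a)) by have := leq_mul al5 n6; lia.
  by rewrite defH /b; lia.
have n_le : n <= H * b.+1 by apply: leq_trans size_le; rewrite leq_pmull.
have b_gt : b0 < b.
  by have := leq_trans n_ge n_le; rewrite leq_pmul2l ?defH // ltnS.
exists a, b; split=> //; [by rewrite /a; lia | by rewrite /a; lia |].
split; first by lia.
  by rewrite /b mulnC leq_trunc_div.
move=> p s l ln; rewrite mulnA expnMn -expnM => hb.
have hl : (3 * l.+1) ^ 8 <= 2 ^ (b %/ 2).
  apply: leq_trans (hb0 b (ltnW b_gt)); rewrite leq_exp2r // leq_mul2l /=.
  by rewrite ltnS (leq_trans ln).
have := leq_trans hb (leq_mul hl (leqnn _)); rewrite -expnD leq_exp2l // => hs.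
have b32 : b <= 32 * (s * p) by move: hs; clearbody b; clear; lia.
apply: leq_trans size_le _; rewrite (mulnC 64) -mulnA leq_mul2l.
by apply/orP; right; move: b32 b_gt; clearbody b; clear; lia.
Qed.

Theorem theorem1p6 :
  exists (c : rat) (n0 : nat), (0 < c)%R /\
    forall n alpha p : nat,
      n0 <= n -> 1 <= alpha <= n -> 1 <= p ->
      (forall (r s : nat)
          (A : n.-tuple ('I_n * 'I_n) -> rand_stream_alg r ('I_n * 'I_n) s),
          solves_n_pair_reachability alpha p A ->
          (c * ((alpha * n)%:R / p%:R) <= s%:R)%R) /\
      (forall (r s : nat) (A : rand_stream_alg r ('I_n * 'I_n) s),
          solves_triangle_detection alpha p A ->
          (c * ((alpha * n)%:R / p%:R) <= s%:R)%R).
Proof.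
have [K [n0 [K_gt0 params]]] := instance_parameters.
exists (K%:R^-1)%R, n0; split; first by rewrite invr_gt0 ltr0n.
move=> n alpha p n_ge al p_gt0.
have [a [b [a_gt0 a_al a_var a3n [b_gt0 bN space]]]] := params n alpha n_ge al.
have toR s : alpha * n <= K * (s * p) ->
    (K%:R^-1 * ((alpha * n)%:R / p%:R) <= s%:R :> rat)%R.
  move=> h; rewrite mulrC ler_pdivrMr ?ltr0n // ler_pdivrMr ?ltr0n //.
  by rewrite -!natrM ler_nat; lia.
pose N := (512 * b).-1.
have Nb : N.+1 = 512 * b by rewrite /N; lia.
have Nn : N <= n %/ (3 * a) * (a * a) by rewrite /N; lia.
split=> r s A solves; apply: toR.
(* For alpha < 3 the sparse bound 3a exceeds alpha; there [a] is 1 and the dense variant is used. *)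
- pose dense := a == 1.
  have lt0 : 0 < n by lia.
  have lt2 : 2 * a < n by lia.
  pose q := [tuple query a (Ordinal lt0) (Ordinal lt2) i | i < n].
  apply: (space p s n) => //.
  apply: (streaming_lower_bound (G := block_graph a dense)
    (sA := first_stream n a dense) (sB := second_stream n a dense)
    Nb _ _ _ _ (solves q)).
  + exact: block_irreflexive.
  + move=> x y; case: (boolP dense) => den.
      by apply: leq_trans (dense_independence n a_gt0 x y _) a_al.
    apply: leq_trans (sparse_independence n _ a_gt0 x y) _.
    by case/orP: a_var => // a1; rewrite /dense a1 in den.
  + exact: block_stream.
  + by move=> x y; apply: block_reachability => //; rewrite orNb.
- apply: (space p s 1); first by lia.
  apply: (streaming_lower_bound (G := block_graph a true)
    (sA := first_stream n a true) (sB := second_stream n a true) Nb _ _ _ _ solves).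
  + exact: block_irreflexive.
  + by move=> x y; apply: leq_trans (dense_independence n a_gt0 x y _) a_al.
  + exact: block_stream.
  + move=> x y; rewrite (dense_triangle a_gt0 x y _ Nn) //=.
    by case: [disjoint _ & _].
Qed.
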